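(* Let $G=G_1\ast G_2\ast G_3$ be a free splitting of a group $G$ where each $G_i$ is non-trivial. Then $\mathrm{Out}(G;G_1,G_2,G_3)$ is generated by the six groups $G_{i_j}$ for $i,j\in\{1,2,3\}$ distinct and $\Phi=\prod_{k=1}^3\mathrm{Aut}(G_k)$, subject to the relations: 1. $[f_{i_j}(g),f_{i_k}(h)]=1$ for all $g,h\in G_i$; 2. $f_{i_j}(g)f_{i_k}(g)=\mathrm{Ad}_{G_i}(g)$ for all $g\in G_i$; 3. $\varphi^{-1}f_{i_j}(g)\varphi=f_{i_j}(\varphi(g))$ for all $g\in G_i$ and all $\varphi\in\Phi$; for all $i\in\{1,2,3\}$ and $\{j,k\}=\{1,2,3\}-\{i\}$.
   Context: $\mathrm{Out}(G;G_1,\dots,G_n)$ is the group of pure symmetric outer automorphisms of the splitting: the subgroup of $\mathrm{Out}(G)$ of those classes having a representative $\psi\in\mathrm{Aut}(G)$ such that for each $i$ there is $g_i\in G$ with $\psi(G_i)=g_i^{-1}G_ig_i$. Automorphisms act on the right, so a product $\psi\chi$ means first $\psi$, then $\chi$. For $i\neq j$, $f_{i_j}(g)$ ($g\in G_i$) is the class of the automorphism of $G$ which sends each $x\in G_j$ to $gxg^{-1}$ and fixes every $G_k$ with $k\ne j$ pointwise; $G_{i_j}=\{f_{i_j}(g):g\in G_i\}$, and $f_{i_j}:G_i\to G_{i_j}$ is an isomorphism. $\Phi$ is identified with the group of (classes of) factor automorphisms, i.e. those $\varphi\in\mathrm{Aut}(G)$ restricting to an automorphism of each $G_i$. $\mathrm{Ad}_{G_i}(g)\in\Phi$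 is the automorphism acting as $x\mapsto g^{-1}xg$ on $G_i$ and trivially on $G_k$, $k\neq i$. ''Generated by groups $K_1,\dots,K_r$ subject to relations $R$'' means: the natural homomorphism from the quotient of the free product $K_1\ast\dots\ast K_r$ by the normal closure of $R$ is an isomorphism onto the group in question. *)

(* Defs.v *)
From HB Require Import structures.
From mathcomp Require Import all_boot.
From mathcomp Require Import boolp classical_sets.

Set Implicit Arguments.
Unset Strict Implicit.
Unset Printing Implicit Defensive.

Local Open Scope group_scope.
Local Open Scope classical_set_scope.
Local Open Scope quotient_scope.

Notation "{ 'hom' G -> H }" := (UMagmaMorphism.type G%type H%type)
  (at level 0, G at level 98, H at level 99,
   format "{ 'hom'  G  ->  H }") : type_scope.

Lemma group_hom (G H : groupType) (f : G -> H) :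
  {morph f : x y / x * y} -> monoid_morphism f.
Proof. by move=> fM; split=> //; apply: (mulIg (f 1)); rewrite -fM !mul1g. Qed.

Section Subgroup.
Variables (G : groupType) (S : groupClosed G).

Definition subgrp := {x : G | x \in S}.

HB.instance Definition _ := [isSub of subgrp for @proj1_sig _ _].
HB.instance Definition _ := [Choice of subgrp by <:].

Definition subgrp_mul (x y : subgrp) : subgrp :=
  exist _ (val x * val y) (gpredM _ _ (valP x) (valP y)).
Definition subgrp_one : subgrp := exist _ 1 gpred1.
Definition subgrp_inv (x : subgrp) : subgrp :=
  exist _ (val x)^-1 (gpredVr _ (valP x)).

Fact subgrp_mulA : associative subgrp_mul.
Proof. by move=> x y z; apply/val_inj; rewrite /= mulgA. Qed.
Fact subgrp_mul1 : left_id subgrp_one subgrp_mul.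
Proof. by move=> x; apply/val_inj; rewrite /= mul1g. Qed.
Fact subgrp_mulr1 : right_id subgrp_one subgrp_mul.
Proof. by move=> x; apply/val_inj; rewrite /= mulg1. Qed.
Fact subgrp_mulV : left_inverse subgrp_one subgrp_inv subgrp_mul.
Proof. by move=> x; apply/val_inj; rewrite /= mulVg. Qed.
Fact subgrp_mulrV : right_inverse subgrp_one subgrp_inv subgrp_mul.
Proof. by move=> x; apply/val_inj; rewrite /= mulgV. Qed.

HB.instance Definition _ := isGroup.Build subgrp
  subgrp_mulA subgrp_mul1 subgrp_mulr1 subgrp_mulV subgrp_mulrV.

Definition sgval (x : subgrp) : G := val x.

Fact sgvalM : {morph sgval : x y / x * y}.
Proof. by []. Qed.
HB.instance Definition _ :=
  isUMagmaMorphism.Build subgrp G sgval (group_hom sgvalM).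

Fact sgval_mem (x : subgrp) : sgval x \in S.
Proof. exact: valP. Qed.
Fact sgval_ex (x : G) : x \in S -> exists y : subgrp, sgval y = x.
Proof. by move=> xS; exists (exist _ x xS). Qed.

End Subgroup.

Section Image.
Variables (G H : groupType) (f : {hom G -> H}).

Definition img : {pred H} := mem (range f).

Fact img_mul : mulg_closed img.
Proof.
move=> u v /set_mem[x _ <-] /set_mem[y _ <-].
by apply/mem_set; exists (x * y) => //; rewrite gmulfM.
Qed.
Fact img_one : 1 \in img.
Proof. by apply/mem_set; exists 1 => //; rewrite gmulf1. Qed.
Fact img_inv : invg_closed img.
Proof.
by move=> u /set_mem[x _ <-]; apply/mem_set; exists x^-1 => //; rewrite gmulfV.
Qed.
HB.instance Definition _ := isMulClosed.Build H img img_mul.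
HB.instance Definition _ := isMul1Closed.Build H img img_one.
HB.instance Definition _ := isInvClosed.Build H img img_inv.

Fact mem_img (x : G) : f x \in img.
Proof. by apply/mem_set; exists x. Qed.

Definition to_img (x : G) : subgrp img := exist _ (f x) (mem_img x).

End Image.

Record normal_subgroup (G : groupType) := NormalSubgroup {
  nsg_group :> groupClosed G;
  nsg_normal : forall x g : G, x \in nsg_group -> x ^ g \in nsg_group
}.

Section Quotient.
Variables (G : groupType) (N : normal_subgroup G).

Definition coset_rel : rel G := fun x y => x^-1 * y \in N.

Fact coset_rel_equiv : equiv_class_of coset_rel.
Proof.
split=> [x|x y|y x z]; rewrite /coset_rel.
- by rewrite mulVg gpred1.
- by rewrite -gpredV invgM invgK.
- by move=> xy yz; rewrite -(mulgK y x^-1) -mulgA gpredM.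
Qed.
Definition coset_equiv := EquivRelPack coset_rel_equiv.

Definition quotg := {eq_quot coset_equiv}.

HB.instance Definition _ := Choice.on quotg.
HB.instance Definition _ := EqQuotient.on quotg.

Definition quotg_mul (a b : quotg) : quotg := \pi_quotg (repr a * repr b).
Definition quotg_inv (a : quotg) : quotg := \pi_quotg (repr a)^-1.
Definition quotg_one : quotg := \pi_quotg 1.

Fact quotg_elim (P : quotg -> Prop) :
  (forall x, P (\pi_quotg x)) -> forall a, P a.
Proof. by move=> PP a; rewrite -[a]reprK. Qed.

Fact repr_piE (x : G) : x^-1 * repr (\pi_quotg x) \in N.
Proof.
have: \pi_quotg x = \pi_quotg (repr (\pi_quotg x)) by rewrite reprK.
by move/eqP; rewrite eqmodE.
Qed.

Fact quotg_piM (x y : G) :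
  quotg_mul (\pi_quotg x) (\pi_quotg y) = \pi_quotg (x * y).
Proof.
apply/eqP; rewrite eq_sym eqmodE /= /coset_rel.
set x' := repr _; set y' := repr _.
have -> : (x * y)^-1 * (x' * y') = (x^-1 * x') ^ y * (y^-1 * y').
  by rewrite /conjg invgM -!mulgA mulVKg.
by apply: gpredM; [exact/nsg_normal/repr_piE|exact: repr_piE].
Qed.

Fact quotg_piV (x : G) : quotg_inv (\pi_quotg x) = \pi_quotg x^-1.
Proof.
apply/eqP; rewrite eqmodE /= /coset_rel invgK.
set x' := repr _.
have -> : x' * x^-1 = (x^-1 * x') ^ x^-1 by rewrite /conjg invgK mulgA mulVKg.
exact/nsg_normal/repr_piE.
Qed.

Fact quotg_mulA : associative quotg_mul.
Proof.
elim/quotg_elim=> x; elim/quotg_elim=> y; elim/quotg_elim=> z.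
by rewrite !quotg_piM mulgA.
Qed.
Fact quotg_mul1 : left_id quotg_one quotg_mul.
Proof. by elim/quotg_elim=> x; rewrite quotg_piM mul1g. Qed.
Fact quotg_mulr1 : right_id quotg_one quotg_mul.
Proof. by elim/quotg_elim=> x; rewrite quotg_piM mulg1. Qed.
Fact quotg_mulV : left_inverse quotg_one quotg_inv quotg_mul.
Proof. by elim/quotg_elim=> x; rewrite quotg_piV quotg_piM mulVg. Qed.
Fact quotg_mulrV : right_inverse quotg_one quotg_inv quotg_mul.
Proof. by elim/quotg_elim=> x; rewrite quotg_piV quotg_piM mulgV. Qed.

HB.instance Definition _ := isGroup.Build quotg
  quotg_mulA quotg_mul1 quotg_mulr1 quotg_mulV quotg_mulrV.

Definition cls (x : G) : quotg := \pi_quotg x.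

Fact clsM : {morph cls : x y / x * y}.
Proof. by move=> x y; rewrite /cls -quotg_piM. Qed.
HB.instance Definition _ :=
  isUMagmaMorphism.Build G quotg cls (group_hom clsM).

End Quotient.

Section NormalClosure.
Variables (G : groupType) (R : set G).

Definition nclosure_pred : {pred G} := mem [set x : G |
  forall N : normal_subgroup G, (forall r, R r -> r \in N) -> x \in N].

Fact nclosure_mul : mulg_closed nclosure_pred.
Proof.
move=> u v /set_mem Pu /set_mem Pv; apply/mem_set=> N RN.
by rewrite gpredM ?Pu ?Pv.
Qed.
Fact nclosure_one : 1 \in nclosure_pred.
Proof. by apply/mem_set=> N RN; rewrite gpred1. Qed.
Fact nclosure_inv : invg_closed nclosure_pred.
Proof. by move=> u /set_mem Pu; apply/mem_set=> N RN; rewrite gpredV Pu. Qed.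
HB.instance Definition _ := isMulClosed.Build G nclosure_pred nclosure_mul.
HB.instance Definition _ := isMul1Closed.Build G nclosure_pred nclosure_one.
HB.instance Definition _ := isInvClosed.Build G nclosure_pred nclosure_inv.

Fact nclosure_normal (x g : G) : x \in nclosure_pred -> x ^ g \in nclosure_pred.
Proof.
by move=> /set_mem Px; apply/mem_set=> N RN; apply: nsg_normal; apply: Px.
Qed.

Definition nclosure : normal_subgroup G := NormalSubgroup nclosure_normal.

End NormalClosure.

Section FreeProduct.
Variables (I : choiceType) (K : I -> groupType).

Definition syllable := {i : I & K i}.
Definition syl (i : I) (x : K i) : syllable := existT _ i x.

(* Words in the [K i], up to the smallest monoid congruence that multiplies
   adjacent letters of a same [K i] and erases units. *)
Inductive fp_eqv : seq syllable -> seq syllable -> Prop :=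
| fp_refl u : fp_eqv u u
| fp_sym u v : fp_eqv u v -> fp_eqv v u
| fp_trans v u w : fp_eqv u v -> fp_eqv v w -> fp_eqv u w
| fp_cat u u' v v' : fp_eqv u u' -> fp_eqv v v' -> fp_eqv (u ++ v) (u' ++ v')
| fp_mul i (x y : K i) : fp_eqv [:: syl x; syl y] [:: syl (x * y)]
| fp_one i : fp_eqv [:: syl (1 : K i)] [::].

Definition fp_rel : rel (seq syllable) := fun u v => `[< fp_eqv u v >].

Fact fp_rel_equiv : equiv_class_of fp_rel.
Proof.
split=> [x|x y|y x z].
- exact/asboolP/fp_refl.
- by apply/asboolP/asboolP; apply: fp_sym.
- by move=> /asboolP xy /asboolP yz; apply/asboolP; apply: fp_trans yz.
Qed.
Definition fp_equiv := EquivRelPack fp_rel_equiv.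

Definition freeprod := {eq_quot fp_equiv}.

HB.instance Definition _ := Choice.on freeprod.
HB.instance Definition _ := EqQuotient.on freeprod.

Definition word_inv (u : seq syllable) : seq syllable :=
  rev [seq (let: existT i x := s in syl x^-1) | s <- u].

Definition freeprod_mul (a b : freeprod) : freeprod := \pi_freeprod (repr a ++ repr b).
Definition freeprod_one : freeprod := \pi_freeprod [::].
Definition freeprod_inv (a : freeprod) : freeprod := \pi_freeprod (word_inv (repr a)).

Fact fp_elim (P : freeprod -> Prop) :
  (forall u, P (\pi_freeprod u)) -> forall a, P a.
Proof. by move=> PP a; rewrite -[a]reprK. Qed.

Fact fp_piP u v : \pi_freeprod u = \pi_freeprod v <-> fp_eqv u v.
Proof.
split=> [/eqP|H]; first by rewrite eqmodE => /asboolP.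
by apply/eqP; rewrite eqmodE; apply/asboolP.
Qed.

Fact repr_fp u : fp_eqv (repr (\pi_freeprod u)) u.
Proof. by apply/fp_piP; rewrite reprK. Qed.

Fact freeprod_piM u v :
  freeprod_mul (\pi_freeprod u) (\pi_freeprod v) = \pi_freeprod (u ++ v).
Proof. by apply/fp_piP/fp_cat; apply: repr_fp. Qed.

Fact word_invP u : fp_eqv (word_inv u ++ u) [::].
Proof.
elim: u => [|[i x] u IHu]; first exact: fp_refl.
rewrite /word_inv /= rev_cons -/(word_inv u) cat_rcons.
apply: fp_trans IHu; apply: fp_cat; first exact: fp_refl.
rewrite -[_ :: _ :: u]/([:: syl x^-1; syl x] ++ u) -[X in fp_eqv _ X]cat0s.
apply: fp_cat; last exact: fp_refl.
by apply: fp_trans (fp_mul _ _) _; rewrite mulVg; apply: fp_one.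
Qed.

Fact word_invK : involutive word_inv.
Proof.
move=> u; rewrite /word_inv map_rev revK -map_comp -[RHS]map_id.
by apply: eq_map => -[i x] /=; rewrite invgK.
Qed.

Fact word_invPr u : fp_eqv (u ++ word_inv u) [::].
Proof. by rewrite -{1}(word_invK u); apply: word_invP. Qed.

Fact freeprod_mulA : associative freeprod_mul.
Proof.
elim/fp_elim=> u; elim/fp_elim=> v; elim/fp_elim=> w.
by rewrite !freeprod_piM catA.
Qed.
Fact freeprod_mul1 : left_id freeprod_one freeprod_mul.
Proof. by elim/fp_elim=> u; rewrite freeprod_piM. Qed.
Fact freeprod_mulr1 : right_id freeprod_one freeprod_mul.
Proof. by elim/fp_elim=> u; rewrite freeprod_piM cats0. Qed.
Fact freeprod_mulV : left_inverse freeprod_one freeprod_inv freeprod_mul.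
Proof.
move=> a; rewrite -[X in freeprod_mul _ X]reprK freeprod_piM.
exact/fp_piP/word_invP.
Qed.
Fact freeprod_mulrV : right_inverse freeprod_one freeprod_inv freeprod_mul.
Proof.
move=> a; rewrite -[X in freeprod_mul X _]reprK freeprod_piM.
exact/fp_piP/word_invPr.
Qed.

HB.instance Definition _ := isGroup.Build freeprod
  freeprod_mulA freeprod_mul1 freeprod_mulr1 freeprod_mulV freeprod_mulrV.

Definition fpin (i : I) (x : K i) : freeprod := \pi_freeprod [:: syl x].

Fact fpinM i : {morph @fpin i : x y / x * y}.
Proof.
by move=> x y; rewrite /fpin [RHS]freeprod_piM; apply/fp_piP/fp_sym/fp_mul.
Qed.
HB.instance Definition _ (i : I) :=
  isUMagmaMorphism.Build (K i) freeprod (@fpin i) (group_hom (@fpinM i)).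

Section Lift.
Variables (L : groupType) (f : forall i, {hom K i -> L}).

Definition word_lift (u : seq syllable) : L :=
  \prod_(s <- u) f (tag s) (tagged s).

Fact word_lift_eqv u v : fp_eqv u v -> word_lift u = word_lift v.
Proof.
elim=> {u v} //.
- by move=> v u w _ -> _ ->.
- by move=> u u' v v' _ e1 _ e2; rewrite /word_lift !big_cat; congr (_ * _).
- by move=> i x y; rewrite /word_lift !big_cons big_nil !mulg1 gmulfM.
- by move=> i; rewrite /word_lift !big_cons big_nil mulg1 /= gmulf1.
Qed.

Definition fplift (a : freeprod) : L := word_lift (repr a).

Fact fplift_pi u : fplift (\pi_freeprod u) = word_lift u.
Proof. by apply: word_lift_eqv; apply: repr_fp. Qed.

Fact fpliftM : {morph fplift : x y / x * y}.
Proof.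
elim/fp_elim=> u; elim/fp_elim=> v; rewrite [_ * _]freeprod_piM !fplift_pi.
by rewrite /word_lift big_cat.
Qed.
HB.instance Definition _ :=
  isUMagmaMorphism.Build freeprod L fplift (group_hom fpliftM).

Fact fplift_in i (x : K i) : fplift (fpin x) = f i x.
Proof. by rewrite /fpin fplift_pi /word_lift big_cons big_nil mulg1. Qed.

End Lift.

Fact freeprod_ext (L : groupType) (f f' : {hom freeprod -> L}) :
  (forall i (x : K i), f (fpin x) = f' (fpin x)) -> f =1 f'.
Proof.
move=> e; elim/fp_elim; elim=> [|[i x] u IHu].
  by rewrite -[\pi_freeprod _]/(1 : freeprod) !gmulf1.
have -> : \pi_freeprod (existT _ i x :: u) = fpin x * \pi_freeprod u.
  by rewrite [RHS]freeprod_piM.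
by rewrite !gmulfM e IHu.
Qed.

End FreeProduct.

(* [L] is generated by the groups [K i], mapped to [L] by the [f i], subject to
   [R]: the morphism to [L] induced by the [f i] on the quotient of the free
   product by the normal closure of [R] is well defined and bijective. *)
Definition presented_by (I : choiceType) (K : I -> groupType) (L : groupType)
    (f : forall i, {hom K i -> L}) (R : set (freeprod K)) : Prop :=
  exists theta : {hom quotg (nclosure R) -> L},
    (forall i (x : K i), theta (cls _ (fpin x)) = f i x) /\ bijective theta.

Section Aut.
Variable G : groupType.

Record aut := Aut {
  aut_fun :> G -> G;
  aut_inv : G -> G;
  autM : {morph aut_fun : x y / x * y};
  autK : cancel aut_fun aut_inv;
  autVK : cancel aut_inv aut_fun
}.

HB.instance Definition _ (f : aut) :=
  isUMagmaMorphism.Build G G (aut_fun f) (group_hom (@autM f)).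

HB.instance Definition _ := gen_eqMixin aut.
HB.instance Definition _ := gen_choiceMixin aut.

Lemma aut_ext (f g : aut) : f =1 g -> f = g.
Proof.
case: f g => [f f' fM fK f'K] [g g' gM gK g'K] /= /funext fg; subst g.
have e : f' = g'.
  by apply/funext => x; apply: (can_inj fK); rewrite f'K g'K.
by subst g'; congr Aut; apply: Prop_irrelevance.
Qed.

(* Automorphisms act on the right: [f * g] is [f] followed by [g]. *)
Fact aut_mul_subproof (f g : aut) : {morph g \o f : x y / x * y}.
Proof. by move=> x y; rewrite /= !autM. Qed.
Definition aut_mul (f g : aut) : aut :=
  Aut (aut_mul_subproof f g) (can_comp (autK g) (autK f))
      (can_comp (autVK f) (autVK g)).
Definition aut_one : aut :=
  @Aut idfun idfun (fun _ _ => erefl) (fun _ => erefl) (fun _ => erefl).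
Definition aut_invg (f : aut) : aut :=
  Aut (can2_gmulfM (autK f) (autVK f)) (autVK f) (autK f).

Fact aut_mulA : associative aut_mul.
Proof. by move=> f g h; apply: aut_ext. Qed.
Fact aut_mul1 : left_id aut_one aut_mul.
Proof. by move=> f; apply: aut_ext. Qed.
Fact aut_mulr1 : right_id aut_one aut_mul.
Proof. by move=> f; apply: aut_ext. Qed.
Fact aut_mulV : left_inverse aut_one aut_invg aut_mul.
Proof. by move=> f; apply: aut_ext => x; apply: autVK. Qed.
Fact aut_mulrV : right_inverse aut_one aut_invg aut_mul.
Proof. by move=> f; apply: aut_ext => x; apply: autK. Qed.

HB.instance Definition _ := isGroup.Build aut
  aut_mulA aut_mul1 aut_mulr1 aut_mulV aut_mulrV.

(* As automorphisms act on the right, [g |-> (x |-> g^-1 x g)] is a morphism. *)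
Fact inner_subproof (g : G) : {morph conjg^~ g : x y / x * y}.
Proof. by move=> x y; rewrite conjMg. Qed.
Definition inner (g : G) : aut :=
  Aut (inner_subproof g) (conjgK g) (conjgKV g).

Fact innerM : {morph inner : x y / x * y}.
Proof. by move=> x y; apply: aut_ext => z /=; rewrite conjgM. Qed.
HB.instance Definition _ :=
  isUMagmaMorphism.Build G aut inner (group_hom innerM).

Fact inner_normal (a f : aut) : a \in img inner -> a ^ f \in img inner.
Proof.
move=> /set_mem[g _ <-]; apply/mem_set; exists (f g) => //.
apply: aut_ext => x; transitivity (f (aut_inv f x) ^ f g); first by rewrite autVK.
exact/esym/gmulfJ.
Qed.

Definition inn : normal_subgroup aut := NormalSubgroup inner_normal.

Definition out : groupType := quotg inn.
Definition ocls (f : aut) : out := cls inn f.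
HB.instance Definition _ :=
  isUMagmaMorphism.Build aut out ocls (group_hom (@clsM _ inn)).

End Aut.

Section DirectProduct.
Variables (I : Type) (K : I -> groupType).

Definition dprodg := forall i, K i.
HB.instance Definition _ := Choice.on dprodg.

Definition dprodg_mul (x y : dprodg) : dprodg := fun i => x i * y i.
Definition dprodg_one : dprodg := fun i => 1.
Definition dprodg_inv (x : dprodg) : dprodg := fun i => (x i)^-1.

Fact dprodg_mulA : associative dprodg_mul.
Proof. by move=> x y z; apply/functional_extensionality_dep=> i; apply: mulgA. Qed.
Fact dprodg_mul1 : left_id dprodg_one dprodg_mul.
Proof. by move=> x; apply/functional_extensionality_dep=> i; apply: mul1g. Qed.
Fact dprodg_mulr1 : right_id dprodg_one dprodg_mul.
Proof. by move=> x; apply/functional_extensionality_dep=> i; apply: mulg1. Qed.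
Fact dprodg_mulV : left_inverse dprodg_one dprodg_inv dprodg_mul.
Proof. by move=> x; apply/functional_extensionality_dep=> i; apply: mulVg. Qed.
Fact dprodg_mulrV : right_inverse dprodg_one dprodg_inv dprodg_mul.
Proof. by move=> x; apply/functional_extensionality_dep=> i; apply: mulgV. Qed.

HB.instance Definition _ := isGroup.Build dprodg
  dprodg_mulA dprodg_mul1 dprodg_mulr1 dprodg_mulV dprodg_mulrV.

End DirectProduct.

(* [G] is the free product of its subgroups [factor i]. *)
Record free_splitting (I : choiceType) (G : groupType) := FreeSplitting {
  factor :> I -> groupClosed G;
  factorP : bijective
    (fplift (fun i => @sgval G (factor i) : {hom subgrp (factor i) -> G}))
}.

Section Splitting.
Variables (I : choiceType) (G : groupType) (S : free_splitting I G).

Fact splitting_decomp : {dec : {hom G -> freeprod (fun i => subgrp (S i))} |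
  cancel dec (fplift (fun i => @sgval G (S i) : {hom subgrp (S i) -> G})) /\
  forall i (x : subgrp (S i)), dec (sgval x) = fpin x}.
Proof.
apply: cid; have [dec decK fpliftK] := factorP S.
pose decH := isUMagmaMorphism.Build _ _ dec
  (group_hom (can2_gmulfM decK fpliftK)).
pose dech : {hom G -> freeprod (fun i => subgrp (S i))} :=
  HB.pack dec decH.
exists dech; split=> [//|i x /=]; rewrite -[RHS]decK; congr (dec _).
by rewrite fplift_in.
Qed.

Definition slift (L : groupType) (f : forall i, {hom subgrp (S i) -> L})
  (a : G) : L := fplift f (sval splitting_decomp a).

Fact sliftM (L : groupType) (f : forall i, {hom subgrp (S i) -> L}) :
  {morph slift f : x y / x * y}.
Proof. by move=> x y; rewrite /slift !gmulfM. Qed.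
HB.instance Definition _ (L : groupType) (f : forall i, {hom subgrp (S i) -> L}) :=
  isUMagmaMorphism.Build G L (slift f) (group_hom (sliftM f)).

Fact slift_in (L : groupType) (f : forall i, {hom subgrp (S i) -> L})
  i (x : subgrp (S i)) : slift f (sgval x) = f i x.
Proof. by rewrite /slift (svalP splitting_decomp).2 fplift_in. Qed.

Fact slift_ext (L : groupType) (f f' : {hom G -> L}) :
  (forall i (x : subgrp (S i)), f (sgval x) = f' (sgval x)) -> f =1 f'.
Proof.
move=> e a; rewrite -((svalP splitting_decomp).1 a).
set v := fplift _.
apply: (@freeprod_ext _ _ _ (f \o v : {hom _ -> _}) (f' \o v : {hom _ -> _})).
by move=> i x /=; rewrite /v fplift_in e.
Qed.

Section SplittingAut.
Variables f f' : forall i, {hom subgrp (S i) -> G}.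
Hypothesis ff' : forall i (x : subgrp (S i)), slift f' (f i x) = sgval x.
Hypothesis f'f : forall i (x : subgrp (S i)), slift f (f' i x) = sgval x.

Fact slift_can (h h' : forall i, {hom subgrp (S i) -> G}) :
  (forall i (x : subgrp (S i)), slift h' (h i x) = sgval x) ->
  cancel (slift h) (slift h').
Proof.
move=> hh'.
apply: (@slift_ext _ (slift h' \o slift h : {hom _ -> _}) (idfun : {hom G -> G})).
by move=> i x /=; rewrite slift_in hh'.
Qed.

Definition slift_aut : aut G :=
  Aut (sliftM f) (slift_can ff') (slift_can f'f).
End SplittingAut.

(* [Phi] acts on [G] by the factor automorphisms [factor_aut]. *)
Definition Phi := dprodg (fun k => aut (subgrp (S k))).
HB.instance Definition _ := Group.on Phi.

Definition Ad (i : I) (g : subgrp (S i)) : Phi :=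
  dfwith (1 : Phi) (inner g).

Section FactorAut.
Definition factor_hom (phi : Phi) k : {hom subgrp (S k) -> G} :=
  @sgval G (S k) \o phi k.

Fact factor_homM (phi chi : Phi) k (x : subgrp (S k)) :
  slift (factor_hom chi) (factor_hom phi k x) = factor_hom (phi * chi) k x.
Proof. by rewrite /= slift_in. Qed.

Fact factor_homV (phi : Phi) k (x : subgrp (S k)) :
  slift (factor_hom phi^-1) (factor_hom phi k x) = sgval x.
Proof. by rewrite factor_homM mulgV. Qed.

Fact factor_homVl (phi : Phi) k (x : subgrp (S k)) :
  slift (factor_hom phi) (factor_hom phi^-1 k x) = sgval x.
Proof. by rewrite factor_homM mulVg. Qed.

Definition factor_aut (phi : Phi) : aut G :=
  slift_aut (factor_homV phi) (factor_homVl phi).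

Fact factor_autE (phi : Phi) k (x : subgrp (S k)) :
  factor_aut phi (sgval x) = sgval (phi k x).
Proof. by rewrite [LHS]slift_in. Qed.

Fact factor_autM : {morph factor_aut : phi chi / phi * chi}.
Proof.
move=> phi chi; apply/aut_ext/(@slift_ext _ (factor_aut (phi * chi) : {hom _ -> _})
  (factor_aut phi * factor_aut chi : {hom _ -> _})) => k x.
apply: etrans (factor_autE _ _) (esym _).
by apply: etrans (congr1 (factor_aut chi) (factor_autE phi x)) (factor_autE _ _).
Qed.

End FactorAut.

Section PartialConj.
Variables (i j : I) (ij : i != j).

Definition pconj_fun (g : subgrp (S i)) k (x : subgrp (S k)) : G :=
  if k == j then sgval g * sgval x * (sgval g)^-1 else sgval x.

Fact pconj_funM g k : {morph @pconj_fun g k : x y / x * y}.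
Proof.
move=> x y; rewrite /pconj_fun; case: eqP => // _.
by rewrite gmulfM !mulgA mulgVK.
Qed.
HB.instance Definition _ g k :=
  isUMagmaMorphism.Build (subgrp (S k)) G (@pconj_fun g k)
    (group_hom (@pconj_funM g k)).

Definition pconj_hom (g : subgrp (S i)) k : {hom subgrp (S k) -> G} :=
  @pconj_fun g k.

Fact pconj_homM (g h : subgrp (S i)) k (x : subgrp (S k)) :
  slift (pconj_hom h) (pconj_hom g k x) = pconj_hom (g * h) k x.
Proof.
have fixg : slift (pconj_hom h) (sgval g) = sgval g.
  by rewrite slift_in /= /pconj_fun (negbTE ij).
rewrite /= /pconj_fun; case kj: (k == j).
  have -> : (sgval g)^-1 = sgval g^-1 by rewrite gmulfV.
  rewrite !sliftM fixg !slift_in /= /pconj_fun kj (negbTE ij).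
  by rewrite gmulfM gmulfV invgM !mulgA.
by rewrite slift_in /= /pconj_fun kj.
Qed.

Fact pconj_hom1 k (x : subgrp (S k)) : pconj_hom 1 k x = sgval x.
Proof. by rewrite /= /pconj_fun gmulf1 invg1 mul1g mulg1 if_same. Qed.

Fact pconj_homV (g : subgrp (S i)) k (x : subgrp (S k)) :
  slift (pconj_hom g^-1) (pconj_hom g k x) = sgval x.
Proof. by rewrite pconj_homM mulgV pconj_hom1. Qed.

Fact pconj_homVl (g : subgrp (S i)) k (x : subgrp (S k)) :
  slift (pconj_hom g) (pconj_hom g^-1 k x) = sgval x.
Proof. by rewrite pconj_homM mulVg pconj_hom1. Qed.

Definition pconj (g : subgrp (S i)) : aut G :=
  slift_aut (pconj_homV g) (pconj_homVl g).

Fact pconjE (g : subgrp (S i)) k (x : subgrp (S k)) :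
  pconj g (sgval x) =
    if k == j then sgval g * sgval x * (sgval g)^-1 else sgval x.
Proof. by rewrite [LHS]slift_in. Qed.

Fact pconjM : {morph pconj : g h / g * h}.
Proof.
move=> g h; apply/aut_ext/(@slift_ext _ (pconj (g * h) : {hom _ -> _})
  (pconj g * pconj h : {hom _ -> _})) => k x.
apply: etrans (slift_in _ _) _; rewrite -pconj_homM.
by apply: (congr1 (pconj h)); apply/esym/slift_in.
Qed.

End PartialConj.

Definition pure_symmetric (psi : aut G) : Prop :=
  forall i, exists g : G,
    psi @` [set` S i] = [set g^-1 * x * g | x in [set` S i]].

Definition pure_out : {pred out G} :=
  mem (@ocls G @` [set psi | pure_symmetric psi]).

Fact pure_symmetric1 : pure_symmetric 1.
Proof.
by move=> i; exists 1; apply: eq_imagel => x _; rewrite invg1 mul1g mulg1.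
Qed.

Fact pure_symmetricM psi chi :
  pure_symmetric psi -> pure_symmetric chi -> pure_symmetric (psi * chi).
Proof.
move=> Ppsi Pchi i; have [g Eg] := Ppsi i; have [h Eh] := Pchi i.
exists (h * chi g).
have -> : (psi * chi) @` [set` S i] = chi @` (psi @` [set` S i]).
  by rewrite image_comp.
have -> : [set (h * chi g)^-1 * x * (h * chi g) | x in [set` S i]] =
    [set (chi g)^-1 * y * chi g | y in chi @` [set` S i]].
  by rewrite Eh image_comp; apply: eq_imagel => x _ /=; rewrite invgM !mulgA.
rewrite Eg !image_comp; apply: eq_imagel => x _ /=.
by rewrite !gmulfM gmulfV.
Qed.

Fact pure_symmetricV psi : pure_symmetric psi -> pure_symmetric psi^-1.
Proof.
move=> Ppsi i; have [g Eg] := Ppsi i.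
have psiK : cancel psi (psi^-1 : aut G) by apply: autK.
move: (psi^-1) psiK => chi psiK; exists (chi g^-1).
have {1}-> : [set` S i] = [set g * y * g^-1 | y in psi @` [set` S i]].
  rewrite Eg image_comp -[LHS]image_id; apply: eq_imagel => x _ /=.
  by rewrite -!mulgA mulgV mulg1 mulVKg.
rewrite !image_comp; apply: eq_imagel => x _ /=.
by rewrite !autM psiK gmulfV invgK.
Qed.

Fact pure_out_mul : mulg_closed pure_out.
Proof.
move=> u v /set_mem[psi Ppsi <-] /set_mem[chi Pchi <-]; apply/mem_set.
by exists (psi * chi); [apply: pure_symmetricM|apply: clsM].
Qed.
Fact pure_out_one : 1 \in pure_out.
Proof.
by apply/mem_set; exists 1; [apply: pure_symmetric1|].
Qed.
Fact pure_out_inv : invg_closed pure_out.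
Proof.
move=> u /set_mem[psi Ppsi <-]; apply/mem_set.
by exists psi^-1; [apply: pure_symmetricV|apply/esym/quotg_piV].
Qed.
HB.instance Definition _ := isMulClosed.Build (out G) pure_out pure_out_mul.
HB.instance Definition _ := isMul1Closed.Build (out G) pure_out pure_out_one.
HB.instance Definition _ := isInvClosed.Build (out G) pure_out pure_out_inv.

Definition Out_pure : groupType := subgrp pure_out.

Fact factor_aut_pure phi : pure_symmetric (factor_aut phi).
Proof.
move=> i; exists 1.
have -> : [set 1^-1 * x * 1 | x in [set` S i]] = [set` S i].
  by rewrite -[RHS]image_id; apply: eq_imagel => x _; rewrite invg1 mul1g mulg1.
apply/seteqP; split=> [_ [_ /sgval_ex[x <-] <-]|_ /sgval_ex[x <-]].
  by rewrite factor_autE; apply: sgval_mem.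
exists (sgval ((phi i)^-1 x)); first exact: sgval_mem.
by rewrite factor_autE; congr sgval; apply: autVK.
Qed.

Fact pconj_pure i j (ij : i != j) g : pure_symmetric (pconj ij g).
Proof.
move=> k; exists (if k == j then (sgval g)^-1 else 1).
apply: eq_imagel => _ /sgval_ex[x <-]; rewrite pconjE.
by case: eqP => _; rewrite ?invgK ?invg1 ?mul1g ?mulg1.
Qed.

Definition Phi_out (phi : Phi) : Out_pure :=
  exist _ (ocls (factor_aut phi))
    (mem_set (imageP (@ocls G) (factor_aut_pure phi))).

Fact Phi_outM : {morph Phi_out : phi chi / phi * chi}.
Proof. by move=> phi chi; apply/val_inj; rewrite /= factor_autM; apply: clsM. Qed.
HB.instance Definition _ :=
  isUMagmaMorphism.Build Phi Out_pure Phi_out (group_hom Phi_outM).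

Section Generators.
Variables (i j : I) (ij : i != j).

(* [fcls ij g] is $f_{i_j}(g)$, viewed in the pure symmetric subgroup [Out_pure]
   of [out G], and [Gfac ij] is $G_{i_j}$. *)
Definition fcls (g : subgrp (S i)) : Out_pure :=
  exist _ (ocls (pconj ij g)) (mem_set (imageP (@ocls G) (pconj_pure ij g))).

Fact fclsM : {morph fcls : g h / g * h}.
Proof. by move=> g h; apply/val_inj; rewrite /= pconjM; apply: clsM. Qed.
HB.instance Definition _ :=
  isUMagmaMorphism.Build (subgrp (S i)) Out_pure fcls (group_hom fclsM).

Definition Gfac : groupClosed Out_pure := img fcls.

End Generators.

(* [Some (i, j)] indexes $G_{i_j}$ and [None] indexes $\Phi$. *)
Definition gen_idx := option {p : I * I | p.1 != p.2}.

Definition gen_grp (a : gen_idx) : groupType :=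
  match a with
  | Some p => subgrp (Gfac (proj2_sig p))
  | None => Phi
  end.

Definition gen_hom (a : gen_idx) : {hom gen_grp a -> Out_pure} :=
  match a with
  | Some p => @sgval Out_pure (Gfac (proj2_sig p))
  | None => Phi_out
  end.

Definition gen_free := @freeprod gen_idx gen_grp.

Definition gen_f i j (ij : i != j) (g : subgrp (S i)) : gen_free :=
  @fpin gen_idx gen_grp (Some (exist _ (i, j) ij)) (to_img (fcls ij) g).

Definition gen_Phi (phi : Phi) : gen_free :=
  @fpin gen_idx gen_grp None phi.

End Splitting.

Section Relators.
Variables (G : groupType) (S : free_splitting 'I_3 G).

(* An equation [u = v] is encoded by the relator [u / v]. *)
Inductive relator : set (gen_free S) :=
| rel_comm (i j k : 'I_3) (ij : i != j) (ik : i != k) (jk : j != k)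
    (g h : subgrp (S i)) :
    relator [~ gen_f ij g, gen_f ik h]
| rel_Ad (i j k : 'I_3) (ij : i != j) (ik : i != k) (jk : j != k)
    (g : subgrp (S i)) :
    relator (gen_f ij g * gen_f ik g / gen_Phi (Ad g))
| rel_conj (i j : 'I_3) (ij : i != j) (g : subgrp (S i)) (phi : Phi S) :
    relator ((gen_Phi phi)^-1 * gen_f ij g * gen_Phi phi
             / gen_f ij (phi i g)).

End Relators.

(* Main.v *)
From HB Require Import structures.
Require Import Defs.
From mathcomp Require Import all_boot.
From mathcomp Require Import boolp classical_sets zify.

(** The group presented by the generators and relations is a semidirect product
    [F x| Phi], where [F] is a copy of [G_1 * G_2 * G_3] in which [G_i] is embedded
    by [f_{i_{i+1}}] (indices modulo 3): relation 2 expresses the other generator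
    [f_{i_{i+2}}(g)] as [f_{i_{i+1}}(g)^-1 Ad(g)], and relation 3 lets [Phi] act.

    A pure symmetric automorphism [psi] conjugates each [G_i] by some [g_i]; let
    [c_ij = g_i / g_j].  Composing [f_{i_j}(a)] with [psi] multiplies [c_ij] on the
    left by an element of [G_i] and fixes [c_ik].  Call [i] folded if [c_ij] and [c_ik]
    have the same leading letter in [G_i]; at most one index is not folded.

    Surjectivity: if [i] is not folded, a suitable [f_{i_j}(a)] folds it and decreases
    the total length of the [c_ij].  If every index is folded, the [g_i] can be chosen
    so that no cancellation occurs in [psi(w)] for [w] reduced; as [psi] is onto, all
    [g_i] are then trivial up to a common right factor, so that [psi] is a factor
    automorphism up to an inner one.

    Injectivity: when the letters of a reduced word of [F] are composed one after the
    other, each letter in [G_i] finds [i] folded and makes it not folded; but all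
    indices are folded for an inner automorphism. *)

Set Implicit Arguments.
Unset Strict Implicit.
Unset Printing Implicit Defensive.

(** * Normal forms in free products *)

Section NormalForm.
Local Open Scope group_scope.
Local Open Scope quotient_scope.
Variables (I : choiceType) (K : I -> groupType).
Local Notation word := (seq (syllable K)).
Local Notation FP := (freeprod K).
Implicit Types (u v w : word) (a b : FP).

Definition starts i w := if w is s :: _ then tag s == i else false.

Definition hd i w : K i := if w is s :: _ then untag 1 (fun x : K i => x) s else 1.

Definition tl i w := if starts i w then behead w else w.

Definition consn i (x : K i) w := if x == 1 then w else syl x :: w.

Definition reduced w :=
  all (fun s : syllable K => tagged s != 1) w &&
  sorted (fun s t : syllable K => tag s != tag t) w.

(** Van der Waerden's trick: [K i] acts on reduced words by splitting off the leading letter in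
    [K i] (the unit if there is none), multiplying it, and putting it back unless it is trivial. *)
Definition lact i (x : K i) w := consn (x * hd i w) (tl i w).

Definition act u w := foldr (fun s : syllable K => lact (tagged s)) w u.

Lemma hd_syl i (x : K i) w : hd i (syl x :: w) = x.
Proof. by rewrite /= (@untagE _ _ _ _ _ _ (syl x) erefl). Qed.

Lemma hd_nstart i w : ~~ starts i w -> hd i w = 1.
Proof. by case: w => //= s w; apply: untag_dflt. Qed.

Lemma startsP i w : starts i w -> exists x w', w = syl (x : K i) :: w'.
Proof. by case: w => [//|[j x] w] /= /eqP ji; subst j; exists x, w. Qed.

Lemma reduced_cons i (x : K i) w :
  reduced (syl x :: w) = [&& x != 1, ~~ starts i w & reduced w].
Proof.
rewrite /reduced /=; case: (x != 1) => //=.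
by case: w => [|s w] //=; rewrite [i == _]eq_sym; case: (tag s != i); rewrite ?andbF.
Qed.

Lemma hd_eq1 i w : reduced w -> (hd i w == 1) = ~~ starts i w.
Proof.
move=> rw; case: (boolP (starts i w)) => [/startsP[x [w' e]]|/hd_nstart->];
  last exact: eqxx.
by move: rw; rewrite e hd_syl reduced_cons => /andP[/negbTE].
Qed.

Lemma reduced_tl i w : reduced w -> reduced (tl i w).
Proof.
by rewrite /tl; case: ifP => // /startsP[x [w' ->]]; rewrite reduced_cons => /and3P[].
Qed.

Lemma nstarts_tl i w : reduced w -> ~~ starts i (tl i w).
Proof.
rewrite /tl; case: ifP => [/startsP[x [w' ->]]|-> //].
by rewrite reduced_cons => /and3P[].
Qed.

Lemma consn_hdtl i w : reduced w -> consn (hd i w) (tl i w) = w.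
Proof.
move=> rw; rewrite /consn hd_eq1 // /tl; case: (boolP (starts i w)) => //=.
by move=> /startsP[x [w' ->]]; rewrite hd_syl.
Qed.

Lemma reduced_consn i (x : K i) w :
  reduced w -> ~~ starts i w -> reduced (consn x w).
Proof.
by rewrite /consn; case: ifP => // x1 rw sw; rewrite reduced_cons x1 sw.
Qed.

Lemma hd_consn i (x : K i) w : ~~ starts i w -> hd i (consn x w) = x.
Proof.
by rewrite /consn; case: eqP => [-> /hd_nstart //|_ _]; rewrite hd_syl.
Qed.

Lemma tl_consn i (x : K i) w : ~~ starts i w -> tl i (consn x w) = w.
Proof.
rewrite /consn /tl; case: eqP => [_ /negbTE->//|_ _].
by rewrite /starts /= eqxx.
Qed.

Lemma lact_reduced i (x : K i) w : reduced w -> reduced (lact x w).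
Proof. by move=> rw; rewrite reduced_consn ?reduced_tl ?nstarts_tl. Qed.

Lemma lactM i (x y : K i) w : reduced w -> lact x (lact y w) = lact (x * y) w.
Proof.
by move=> rw; rewrite /lact hd_consn ?tl_consn ?nstarts_tl // mulgA.
Qed.

Lemma lact1 i w : reduced w -> lact (1 : K i) w = w.
Proof. by move=> rw; rewrite /lact mul1g consn_hdtl. Qed.

Lemma act_reduced u w : reduced w -> reduced (act u w).
Proof. by move=> rw; elim: u => //= s u; apply: lact_reduced. Qed.

(** The action respects the congruence defining the free product; this makes [nf] independent of the
    representative. *)
Lemma act_eqv u v w : fp_eqv u v -> reduced w -> act u w = act v w.
Proof.
move=> uv; elim: uv w => {u v} //.
- by move=> u v _ IH w rw; rewrite IH.
- by move=> v u v' _ IHu _ IHv w rw; rewrite IHu // IHv.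
- move=> u u' v v' _ IHu _ IHv w rw; rewrite /act !foldr_cat -!/(act _ _).
  by rewrite IHv // IHu // act_reduced.
- by move=> i x y w rw /=; rewrite lactM.
- by move=> i w rw /=; rewrite lact1.
Qed.

Lemma act_nil u : reduced u -> act u [::] = u.
Proof.
elim: u => //= -[i x] u IHu; rewrite reduced_cons => /and3P[x1 su ru].
rewrite IHu // /lact hd_nstart // /tl (negbTE su) mulg1 /consn /=.
by rewrite (negbTE x1).
Qed.

Definition nf a := act (repr a) [::].

Lemma nf_reduced a : reduced (nf a).
Proof. exact: act_reduced. Qed.

Lemma nf_pi u : nf (\pi_FP u) = act u [::].
Proof. by apply: act_eqv => //; apply: repr_fp. Qed.

Lemma nf_piK u : reduced u -> nf (\pi_FP u) = u.
Proof. by move=> ru; rewrite nf_pi act_nil. Qed.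

Lemma pi_cons i (x : K i) u : \pi_FP (syl x :: u) = fpin x * \pi_FP u.
Proof. by rewrite [RHS]freeprod_piM. Qed.

Lemma pi_consn i (x : K i) u : \pi_FP (consn x u) = fpin x * \pi_FP u.
Proof.
rewrite /consn; case: eqP => [->|_]; last exact: pi_cons.
by rewrite gmulf1 mul1g.
Qed.

Lemma pi_lact i (x : K i) u : reduced u -> \pi_FP (lact x u) = fpin x * \pi_FP u.
Proof.
move=> ru; rewrite /lact pi_consn gmulfM -mulgA; congr (_ * _).
by rewrite -pi_consn consn_hdtl.
Qed.

Lemma nfK a : \pi_FP (nf a) = a.
Proof.
rewrite -[RHS]reprK /nf; elim: (repr a) => //= -[i x] u IHu.
by rewrite pi_lact ?act_reduced // IHu -pi_cons.
Qed.

Lemma nf_inj : injective nf.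
Proof. by move=> a b e; rewrite -[a]nfK e nfK. Qed.

Lemma nf_cat a b : reduced (nf a ++ nf b) -> nf (a * b) = nf a ++ nf b.
Proof.
move=> r; rewrite -[RHS]nf_piK //.
by rewrite -[in LHS](nfK a) -[in LHS](nfK b) [_ * _]freeprod_piM.
Qed.

Lemma nf_fpinM i (x : K i) a : nf (fpin x * a) = lact x (nf a).
Proof.
rewrite -[in LHS](nfK a) -pi_lact ?nf_reduced // nf_piK //.
exact/lact_reduced/nf_reduced.
Qed.

Lemma nf1 : nf 1 = [::].
Proof. exact: (@nf_piK [::]). Qed.

Lemma nf_fpin i (x : K i) : nf (fpin x) = consn x [::].
Proof. by rewrite -[fpin x]mulg1 nf_fpinM nf1 /lact mulg1. Qed.

Lemma reduced_inv w : reduced w -> reduced (word_inv w).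
Proof.
rewrite /reduced /word_inv => /andP[aw sw]; apply/andP; split.
  rewrite all_rev all_map; apply: sub_all aw => -[i x] /=.
  by rewrite invg_eq1.
rewrite rev_sorted sorted_map; apply: sub_sorted sw => -[i x] [j y] /=.
by rewrite eq_sym.
Qed.

Lemma nfV a : nf a^-1 = word_inv (nf a).
Proof.
rewrite -[RHS]nf_piK ?reduced_inv ?nf_reduced //; congr nf.
apply: (mulIg a); rewrite mulVg -[in RHS](nfK a) [RHS]freeprod_piM.
by apply: esym; apply/fp_piP; rewrite nfK; apply: word_invP.
Qed.

(** The value is 1 when the normal form does not start in [K i]; with this default [leadM] needs no
    case distinction. *)
Definition lead i a : K i := hd i (nf a).
Definition len a := size (nf a).

Lemma lenV a : len a^-1 = len a.
Proof. by rewrite /len nfV /word_inv size_rev size_map. Qed.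

Lemma len_eq0 a : len a = 0%N -> a = 1.
Proof. by move/size0nil => e; apply: nf_inj; rewrite e nf1. Qed.

Lemma leadM i (x : K i) a : lead i (fpin x * a) = x * lead i a.
Proof. by rewrite /lead nf_fpinM /lact hd_consn // nstarts_tl ?nf_reduced. Qed.

Lemma lead1 i : lead i 1 = 1.
Proof. by rewrite /lead nf1. Qed.

Lemma lead_fpin i (x : K i) : lead i (fpin x) = x.
Proof. by rewrite -[fpin x]mulg1 leadM lead1 mulg1. Qed.

Lemma lead_fpin_neq i j (x : K i) : i != j -> lead j (fpin x) = 1.
Proof.
move=> ij; rewrite /lead nf_fpin hd_nstart // /consn.
by case: ifP => //= _; rewrite ij.
Qed.

Lemma size_lact i (x : K i) w : size (lact x w) <= (size w).+1.
Proof.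
rewrite /lact /consn /tl; case: ifP => _; case: ifP => //= _; rewrite ?size_behead; lia.
Qed.

Lemma len_fpinM i (x : K i) a : len (fpin x * a) <= (len a).+1.
Proof. by rewrite /len nf_fpinM size_lact. Qed.

Lemma lenM a b : len (a * b) <= len a + len b.
Proof.
rewrite -[in X in X <= _](nfK a) /(len a); elim: (nf a) => [|[i x] u IHu].
  by rewrite -[\pi_FP _]/(1 : FP) mul1g.
rewrite pi_cons -mulgA /= addSn; apply: leq_trans (len_fpinM _ _) _.
by rewrite ltnS.
Qed.

Lemma lead_split i a : exists2 b, a = fpin (lead i a) * b & lead i b = 1.
Proof.
exists ((fpin (lead i a))^-1 * a); first by rewrite mulVKg.
by rewrite -gmulfV leadM mulVg.
Qed.

(** Neither neighbour of [x] lies in [K i], so nothing merges or cancels. *)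
Lemma nf_sandwich i (x : K i) a b : lead i a = 1 -> lead i b = 1 -> x != 1 ->
  nf (a^-1 * (fpin x * b)) = nf a^-1 ++ syl x :: nf b.
Proof.
move=> /eqP + /eqP; rewrite !hd_eq1 ?nf_reduced // => sa sb x1.
have nxb : nf (fpin x * b) = syl x :: nf b.
  by rewrite nf_fpinM /lact /tl (negbTE sb) hd_nstart // mulg1 /consn (negbTE x1).
rewrite nf_cat nxb // nfV.
have := reduced_inv (nf_reduced a); have := nf_reduced b.
have rb : reduced (syl x :: nf b) by rewrite -nxb nf_reduced.
rewrite /reduced all_cat => /andP[_ sb'] /andP[-> _].
have /andP[-> xb] := rb; rewrite /= sorted_cat_cons; apply/andP; split; last exact: xb.
(* The inverse of this reduced word is [nf a^-1] followed by [x], so that junction is reduced. *)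
have : reduced (word_inv (syl x^-1 :: nf a)).
  by apply: reduced_inv; rewrite reduced_cons invg_eq1 x1 sa nf_reduced.
by rewrite /word_inv /= rev_cons invgK => /andP[].
Qed.

Lemma len_sandwich i (x : K i) a b : lead i a = 1 -> lead i b = 1 -> x != 1 ->
  len (a^-1 * (fpin x * b)) = (len a + (len b).+1)%N.
Proof.
by move=> ha hb x1; rewrite /len nf_sandwich // size_cat -!/(len _) lenV.
Qed.

Lemma lead_sandwich i j (x : K i) a b :
    lead i a = 1 -> lead i b = 1 -> x != 1 -> i != j ->
  lead j (a^-1 * (fpin x * b)) = lead j a^-1.
Proof.
move=> ha hb x1 ij; rewrite /lead nf_sandwich //; case: (nf a^-1) => //=.
by rewrite untag_dflt.
Qed.

(** Both [a] and [a * fpin x] arise by appending a letter of [K i], possibly trivial, to the same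
    [b^-1], which does not end in [K i]; such a letter does not affect the start in [K j]. *)
Lemma leadMr i j (x : K i) a : i != j -> lead j (a * fpin x) = lead j a.
Proof.
move=> ij; have [b /(canRL invgK) -> hb] := lead_split i a^-1.
set t := lead i _; rewrite invgM -gmulfV.
rewrite -mulgA -gmulfM; set y := _ * x.
have H (z : K i) : lead j (b^-1 * fpin z) = lead j b^-1.
  have [->|z1] := eqVneq z 1; first by rewrite gmulf1 mulg1.
  by rewrite -[fpin z]mulg1 lead_sandwich ?lead1.
by rewrite !H.
Qed.

Lemma len_fpin i (x : K i) : len (fpin x) <= 1.
Proof. by rewrite /len nf_fpin /consn; case: ifP. Qed.

(** Strip from [z] its leading letter in [K i]: conjugating by the rest [b] gives length
    [2 * len b + 1], so [b] must be trivial. *)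
Lemma malnormal i (x y : K i) z :
  x != 1 -> fpin x ^ z = fpin y -> exists t : K i, z = fpin t.
Proof.
have [b -> hb] := lead_split i z; set t := lead i z => x1.
rewrite conjgM -gmulfJ conjgE => e; exists t.
suff /len_eq0-> : len b = 0%N by rewrite mulg1.
have := len_fpin y; rewrite -e len_sandwich ?conjg_eq1 //; lia.
Qed.

(** The distinct leading letters [x] and [y] leave the non-trivial [x^-1 * y] in the middle of
    [a^-1 * b], and what precedes it comes from [a^-1]. *)
Lemma leads_tri i j k a b : i != j -> i != k -> j != k ->
  lead i a != lead i b -> lead j (a^-1 * b) = lead j a^-1.
Proof.
move=> ij ik jk; have [a' -> ha] := lead_split i a; have [b' -> hb] := lead_split i b.
rewrite !leadM ha hb !mulg1; set x := lead i a; set y := lead i b => xy.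
rewrite invgM -mulgA mulgA -gmulfV leadMr // mulgA -[X in X * _]mulgA -gmulfM -mulgA.
by rewrite lead_sandwich // -(inj_eq (@mulgI _ x)) mulVKg mulg1 eq_sym.
Qed.

End NormalForm.

(** * Conjugating elements of pure symmetric automorphisms *)

Section Marking.
Local Open Scope group_scope.
Variables (I : choiceType) (G : groupType) (S : free_splitting I G).
Local Notation K := (fun i => subgrp (S i)).
Local Notation F := (freeprod K).

Definition dec : {hom G -> F} := sval (splitting_decomp S).

Definition undec : {hom F -> G} :=
  fplift (fun i => @sgval G (S i) : {hom subgrp (S i) -> G}).

Lemma decK : cancel dec undec.
Proof. exact: (svalP (splitting_decomp S)).1. Qed.

Lemma dec_sgval i (x : subgrp (S i)) : dec (sgval x) = fpin x.
Proof. exact: (svalP (splitting_decomp S)).2. Qed.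

Lemma undec_fpin i (x : subgrp (S i)) : undec (fpin x) = sgval x.
Proof. exact: fplift_in. Qed.

Lemma undecK : cancel undec dec.
Proof.
apply: (@freeprod_ext _ _ _ (dec \o undec : {hom F -> F}) (idfun : {hom F -> F})).
by move=> i x /=; rewrite undec_fpin dec_sgval.
Qed.

(* [psi] maps the factor [S i] onto its conjugate by [g i], through [phi i]. *)
Definition marking (psi : aut G) (g : I -> F) (phi : Phi S) :=
  forall i (x : subgrp (S i)), dec (psi (sgval x)) = fpin (phi i x) ^ g i.

Lemma marking_ex psi : pure_symmetric S psi -> exists g phi, marking psi g phi.
Proof.
move=> psiP.
have ex i : exists p : G * aut (subgrp (S i)),
    forall x, psi (sgval x) = sgval (p.2 x) ^ p.1.
  have [g Eg] := psiP i.
  (* The inclusion of the image of [S i] in the conjugate gives [f]; the reverse inclusion gives its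
     inverse [f']. *)
  have /choice[f fP] (x : subgrp (S i)) :
      exists y : subgrp (S i), psi (sgval x) = sgval y ^ g.
    have : (psi @` [set` S i])%classic (psi (sgval x)).
      by exists (sgval x) => //; apply: sgval_mem.
    by rewrite Eg => -[_ /sgval_ex[y <-] <-]; exists y; rewrite conjgE mulgA.
  have /choice[f' f'P] (y : subgrp (S i)) :
      exists x : subgrp (S i), psi (sgval x) = sgval y ^ g.
    have : ([set g^-1 * x * g | x in [set` S i]])%classic (sgval y ^ g).
      by exists (sgval y); [apply: sgval_mem | rewrite conjgE mulgA].
    by rewrite -Eg => -[_ /sgval_ex[x <-] <-]; exists x.
  have sI : injective (@sgval G (S i)) by apply: val_inj.
  have fM : {morph f : x y / x * y}.
    by move=> x y; apply/sI/(@conjg_inj _ g); rewrite -fP !gmulfM conjMg -!fP.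
  have fK : cancel f f'.
    by move=> x; apply/sI/(can_inj (autK psi)); rewrite f'P fP.
  have f'K : cancel f' f.
    by move=> y; apply/sI/(@conjg_inj _ g); rewrite -fP f'P.
  by exists (g, Aut fM fK f'K).
exists (fun i => dec (sval (cid (ex i))).1), (fun i => (sval (cid (ex i))).2) => i x.
by rewrite (svalP (cid (ex i))) gmulfJ dec_sgval.
Qed.

Lemma marking_factor phi : marking (factor_aut phi) (fun=> 1) phi.
Proof. by move=> i x; rewrite factor_autE dec_sgval conjg1. Qed.

(** These are the conjugating elements after precomposing [psi] with some [f_{i_j}], where [a]
    already stands for the image under [phi i]; only the element at [j] changes. *)
Definition twist i j (a : subgrp (S i)) (g : I -> F) k : F :=
  if k == j then g j / (fpin a ^ g i) else g k.

Lemma marking_pconj i j (ij : i != j) a psi g phi : marking psi g phi ->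
  marking (pconj ij a * psi) (twist j (phi i a) g) phi.
Proof.
move=> m k x.
rewrite -[LHS]/(dec (psi (pconj ij a (sgval x)))) pconjE /twist.
case: eqP => [kj|_]; last exact: m.
by subst k; rewrite !gmulfM !gmulfV !m [RHS]conjgM [RHS]conjgE invgK [RHS]mulgA.
Qed.

Lemma marking_inner psi g phi h : marking psi g phi ->
  marking (psi * inner h) (fun i => g i * dec h) phi.
Proof.
move=> m i x; rewrite -[LHS]/(dec (psi (sgval x) ^ h)).
by rewrite gmulfJ m conjgM.
Qed.

(** The element [g i] matters only up to left multiplication by [G_i]; [phi i] absorbs the
    change. *)
Lemma marking_shift psi g phi (t : forall i, subgrp (S i)) : marking psi g phi ->
  marking psi (fun i => (fpin (t i))^-1 * g i) (fun i => phi i * inner (t i)).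
Proof.
move=> m i x; rewrite m -[(phi i * _) x]/(phi i x ^ t i).
by rewrite gmulfJ -conjgM mulVKg.
Qed.

Hypothesis nontrivial : forall i, exists2 x : G, x \in S i & x != 1.

Lemma nontriv i : exists x : subgrp (S i), x != 1.
Proof.
have [_ /sgval_ex[x <-] x1] := nontrivial i; exists x.
by apply: contra_neq x1 => ->; rewrite gmulf1.
Qed.

Lemma aut_neq1 (L : groupType) (f : aut L) x : x != 1 -> f x != 1.
Proof. by rewrite gmulf_eq1 //; apply: can_inj (autK f). Qed.

(** The quotient [g i / dec h] conjugates a non-trivial letter of [G_i] into [G_i], hence lies in
    [G_i] by malnormality. *)
Lemma marking_of_inner h g phi : marking (inner h) g phi ->
  exists z : forall i, subgrp (S i), forall i, g i = fpin (z i) * dec h.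
Proof.
move=> m; suff H i : exists z : subgrp (S i), g i = fpin z * dec h.
  by exists (fun i => sval (cid (H i))) => i; apply: svalP (cid (H i)).
have [x x1] := nontriv i.
have : fpin (phi i x) ^ (g i * (dec h)^-1) = fpin x.
  by rewrite conjgM -m -[inner h _]/(sgval x ^ h) gmulfJ conjgK dec_sgval.
case/(malnormal (aut_neq1 _ x1)) => t e.
by exists t; rewrite -e mulgVK.
Qed.

(** Induction on the word: if the image [q] of the tail starting in [G_j] satisfies the claim, the
    leading letter of [g j * q] survives in [(g j / g i)^-1 * (g j * q)]. So [g i * q] has the
    trivial leading letter of [g i / g j] in [G_i], and [phi i x] remains. *)
Lemma tight_lead psi g phi : marking psi g phi ->
    (forall i, lead i (g i) = 1) ->
    (forall i j, i != j -> lead i (g i / g j) = 1) ->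
  forall i (x : subgrp (S i)) w, reduced (syl x :: w) ->
    lead i (g i * dec (psi (undec (\pi_F (syl x :: w))%qT))) != 1.
Proof.
move=> m g1 g2 i x w; elim: w i x => [|[j y] w IHw] i x;
    rewrite reduced_cons => /and3P[x1 xw rw];
  rewrite pi_cons !gmulfM undec_fpin m mulgA -conjgC -mulgA leadM.
  rewrite -[(\pi _)%qT]/(1 : F) !gmulf1 mulg1 g1 mulg1.
  exact: aut_neq1.
have := IHw j y rw; set q := dec _ => qj.
have ij : j != i by [].
have -> : g i * q = (g j / g i)^-1 * (g j * q).
  by rewrite invgF mulgA mulgVK.
have [r -> hr] := lead_split j (g j * q).
rewrite lead_sandwich ?g2 // invgF g2 ?mulg1; last by rewrite eq_sym.
exact: aut_neq1.
Qed.

(** By surjectivity a letter [y] of [G_k] is the image of a reduced word, starting in some [G_i].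
    Then [y] is [(g i)^-1 * (fpin z * r)] without cancellation; having length at most 1, it forces
    [g i = 1], and [i = k]. *)
Lemma tight_trivial psi g phi : marking psi g phi ->
    (forall i, lead i (g i) = 1) ->
    (forall i j, i != j -> lead i (g i / g j) = 1) ->
  forall i, g i = 1.
Proof.
move=> m g1 g2 k; have [y y1] := nontriv k.
have e : dec (psi (undec (dec (aut_inv psi (sgval y))))) = fpin y.
  by rewrite decK autVK dec_sgval.
move: e; set d := dec (aut_inv _ _); rewrite -(nfK d); have := nf_reduced d.
case: (nf d) => [_|[i x] w rw].
  rewrite -[(\pi _)%qT]/(1 : F) !gmulf1 => e.
  by case/eqP: y1; rewrite -(@lead_fpin _ K k y) -e lead1.
have := tight_lead m g1 g2 rw; move=> + e; rewrite e.
have [r er hr] := lead_split i (g i * fpin y); set z := lead i _ in er * => z1.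
have {}er : fpin y = (g i)^-1 * (fpin z * r) by rewrite -er mulKg.
have := @len_fpin _ K k y; rewrite er len_sandwich // => l.
have gi : g i = 1 by apply: len_eq0; lia.
have r1 : r = 1 by apply: len_eq0; lia.
move: er; rewrite gi r1 invg1 mul1g mulg1 => eyz.
have [ik|ik] := eqVneq i k; first by rewrite -ik.
by case/eqP: y1; rewrite -(@lead_fpin _ K k y) eyz lead_fpin_neq.
Qed.

Lemma marking_trivial psi g phi : marking psi g phi -> (forall i, g i = 1) ->
  psi = factor_aut phi.
Proof.
move=> m g1; apply/aut_ext/(@slift_ext _ _ S _ (psi : {hom _ -> _})
  (factor_aut phi : {hom _ -> _})) => i x.
by apply: (can_inj decK); rewrite m g1 conjg1
  [RHS](congr1 dec (factor_autE _ _)) dec_sgval.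
Qed.

End Marking.

(** * Folding with three factors *)

Section FoldLength.
Local Open Scope group_scope.
Variables (I : choiceType) (K : I -> groupType).
Implicit Types a b : freeprod K.

Lemma len_lead i (x : K i) a : lead i a != 1 -> len (fpin x * a) <= len a.
Proof.
have [b -> hb] := lead_split i a; rewrite leadM hb mulg1; set y := lead i a => y1.
have -> : len (fpin y * b) = (len b).+1.
  by rewrite -[fpin y * b]mul1g -invg1 len_sandwich ?lead1 // /len nf1.
by rewrite mulgA -gmulfM; apply: len_fpinM.
Qed.

(** Once the leading letters in [K i] agree, the middle letter of [a^-1 * b] disappears. *)
Lemma len_fold i a b : lead i a != lead i b ->
  len ((fpin (lead i b * (lead i a)^-1) * a)^-1 * b) < len (a^-1 * b).
Proof.
have [a' ea ha] := lead_split i a; have [b' eb hb] := lead_split i b.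
move: ea eb; set x := lead i a; set y := lead i b => -> -> xy.
have -> : (fpin (y * x^-1) * (fpin x * a'))^-1 * (fpin y * b') = a'^-1 * b'.
  by rewrite (mulgA _ (fpin x)) -gmulfM mulgVK invgM -mulgA mulKg.
have -> : (fpin x * a')^-1 * (fpin y * b') = a'^-1 * (fpin (x^-1 * y) * b').
  by rewrite invgM gmulfM gmulfV !mulgA.
rewrite len_sandwich //; last by rewrite -(inj_eq (@mulgI _ x)) mulVKg mulg1 eq_sym.
by apply: leq_ltn_trans (lenM _ _) _; rewrite lenV; lia.
Qed.

Lemma len_divC a b : len (a / b) = len (b / a).
Proof. by rewrite -lenV invgF. Qed.

End FoldLength.

(** * Cyclic indexing of the three factors *)

Section Cyclic.

Definition nxt (i : 'I_3) : 'I_3 := inord (i.+1 %% 3).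

Lemma nxt_val (i : 'I_3) : nxt i = i.+1 %% 3 :> nat.
Proof. by rewrite inordK // ltn_mod. Qed.

Lemma nxt_neq i : i != nxt i.
Proof. by rewrite -val_eqE /= nxt_val; case: i => [[|[|[|]]]]. Qed.

Lemma nxt2_neq i : i != nxt (nxt i).
Proof. by rewrite -val_eqE /= !nxt_val; case: i => [[|[|[|]]]]. Qed.

Lemma nxtP i j : i != j -> j = nxt i \/ j = nxt (nxt i).
Proof.
move=> ij; have : (j == nxt i) || (j == nxt (nxt i)).
  by move: ij; rewrite -!val_eqE /= !nxt_val; case: i => [[|[|[|]]]//?];
    case: j => [[|[|[|]]]].
by case/orP => /eqP; [left|right].
Qed.

Lemma third_index (i j : 'I_3) : i != j -> exists2 k, i != k & j != k.
Proof.
move=> /nxtP[]->; last by exists (nxt i); rewrite ?nxt_neq // eq_sym nxt_neq.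
by exists (nxt (nxt i)); rewrite ?nxt2_neq ?nxt_neq.
Qed.

Lemma sum3 (E : 'I_3 -> nat) i j k : i != j -> i != k -> j != k ->
  \sum_(l < 3) E l = (E i + E j + E k)%N.
Proof.
move=> ij ik jk; rewrite (bigD1 i) //= (bigD1 j) 1?eq_sym //= (bigD1 k) /=; last first.
  by rewrite !(eq_sym k) ik jk.
rewrite big_pred0 ?addn0 ?addnA // => l; apply/negbTE; move: ij ik jk.
rewrite -!val_eqE /=; case: i => [[|[|[|]]]//?]; case: j => [[|[|[|]]]//?];
  case: k => [[|[|[|]]]//?]; case: l => [[|[|[|]]]//?].
Qed.

End Cyclic.

(** * Folded indices and the total length of the [c_ij] *)

Section Folded.
Local Open Scope group_scope.
Variable K : 'I_3 -> groupType.
Implicit Types g : 'I_3 -> freeprod K.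

Definition folded g i :=
  lead i (g i / g (nxt i)) == lead i (g i / g (nxt (nxt i))).

Lemma foldedE g i j k : i != j -> i != k -> j != k ->
  folded g i = (lead i (g i / g j) == lead i (g i / g k)).
Proof.
by rewrite /folded => /nxtP[]-> /nxtP[]->; rewrite ?eqxx //.
Qed.

Lemma folded_lead g i j : folded g i -> i != j ->
  lead i (g i / g j) = lead i (g i / g (nxt i)).
Proof. by move=> /eqP e /nxtP[]->. Qed.

(** As [c_jk = c_ij^-1 * c_ik], distinct leading letters of [c_ij] and [c_ik] in [G_i] make [c_jk]
    start in [G_j] as [c_ji] does. *)
Lemma unfolded_uniq g i j : ~~ folded g i -> i != j -> folded g j.
Proof.
move=> + ij; have [k ik jk] := third_index ij.
have ji : j != i by rewrite eq_sym.
rewrite (foldedE _ ij ik jk) (foldedE _ ji jk ik).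
move=> /(leads_tri ij ik jk); rewrite invgF mulgA mulgVK => ->.
exact: eqxx.
Qed.

Definition spread g := (\sum_(i < 3) \sum_(j < 3) len (g i / g j))%N.

Lemma spreadE g i j k : i != j -> i != k -> j != k ->
  spread g = (2 * (len (g i / g j) + len (g i / g k) + len (g j / g k)))%N.
Proof.
move=> ij ik jk; rewrite /spread; under eq_bigr do rewrite (sum3 _ ij ik jk).
rewrite (sum3 _ ij ik jk) !mulgV /len nf1 /= -!/(len _).
rewrite (len_divC (g j) (g i)) (len_divC (g k) (g i)) (len_divC (g k) (g j)); lia.
Qed.

End Folded.

(** * Folding and unfolding by the generators; uniqueness of the resulting words *)

Section Generation.
Local Open Scope group_scope.
Variables (G : groupType) (S : free_splitting 'I_3 G).
Local Notation K := (fun i => subgrp (S i)).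
Local Notation F := (freeprod K).

Lemma twist_same i j k (a : subgrp (S i)) (g : 'I_3 -> F) : k != j ->
  twist j a g k = g k.
Proof. by rewrite /twist => /negbTE ->. Qed.

Lemma twist_divl i j (a : subgrp (S i)) (g : 'I_3 -> F) : i != j ->
  twist j a g i / twist j a g j = fpin a * (g i / g j).
Proof.
move=> ij; rewrite twist_same // /twist eqxx invgF conjgE.
by rewrite !mulgA mulgV mul1g.
Qed.

(** The leading letter of [c_ij] gets multiplied by [a], while that of [c_ik] is kept. *)
Lemma twist_unfold i j (a : subgrp (S i)) (g : 'I_3 -> F) :
  i != j -> a != 1 -> folded g i -> ~~ folded (twist j a g) i.
Proof.
move=> ij a1; have [k ik jk] := third_index ij.
have kj : k != j by rewrite eq_sym.
rewrite !(foldedE _ ij ik jk) twist_divl // leadM !twist_same // => /eqP ->.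
by rewrite -(inj_eq (@mulIg _ (lead i (g i / g k))^-1)) mulgK mulgV.
Qed.

Lemma spread_twist (g : 'I_3 -> F) i : ~~ folded g i ->
  exists j (a : subgrp (S i)), i != j /\ spread (twist j a g) < spread g.
Proof.
(* Of two distinct leading letters at least one is non-trivial; [j] is chosen to be an index where
   it is. *)
suff main j k : i != j -> i != k -> j != k ->
    lead i (g i / g j) != lead i (g i / g k) -> lead i (g i / g j) != 1 ->
    exists a : subgrp (S i), spread (twist j a g) < spread g.
  have ij := nxt_neq i; have ik := nxt2_neq i; have jk := nxt_neq (nxt i).
  move=> nf; have [e|x1] := eqVneq (lead i (g i / g (nxt i))) 1; last first.
    by have [a l] := main _ _ ij ik jk nf x1; exists (nxt i), a.
  have kj : nxt (nxt i) != nxt i by rewrite eq_sym.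
  rewrite /folded eq_sym in nf; have y1 := nf; rewrite e in y1.
  have [a l] := main _ _ ik ij kj nf y1.
  by exists (nxt (nxt i)), a.
move=> ij ik jk xy x1.
(* This factor gives [c_ij] the leading letter of [c_ik]: [c_jk] becomes shorter, [c_ij] does not
   grow since its leading letter was non-trivial, and [c_ik] is unchanged. *)
exists (lead i (g i / g k) * (lead i (g i / g j))^-1).
have kj : k != j by rewrite eq_sym.
rewrite !(spreadE _ ij ik jk) twist_divl // !(twist_same _ _ ij) !(twist_same _ _ kj).
set a := lead i (g i / g k) / lead i (g i / g j).
have -> : twist j a g j / g k = (fpin a * (g i / g j))^-1 * (g i / g k).
  by rewrite -(twist_divl _ _ ij) twist_same // invgF mulgA mulgVK.
have ejk : (g i / g j)^-1 * (g i / g k) = g j / g k.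
  by rewrite invgF mulgA mulgVK.
have := len_fold xy; rewrite ejk -/a ltn_pmul2l // -addnS => l.
by rewrite leq_add // leq_add // len_lead.
Qed.

Hypothesis nontrivial : forall i : 'I_3, exists2 x : G, x \in S i & x != 1.

Lemma folded_factor psi g (phi : Phi S) : marking psi g phi -> (forall i, folded g i) ->
  exists (chi : Phi S) h, psi = factor_aut chi * inner h.
Proof.
(* [t i] is the common leading letter of the [c_ij]; removing it from each [g i] makes these leading
   letters trivial. *)
move=> m fg; pose t i := lead i (g i / g (nxt i)).
have {}m := marking_shift t m.
move: m; set g1 := (fun i => _ * g i); set phi1 := (fun i => _ * _) => m.
have g1P i j : i != j -> lead i (g1 i / g1 j) = 1.
  move=> ij; rewrite /g1 invgM invgK -mulgA -gmulfV leadM mulgA leadMr 1?eq_sym //.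
  by rewrite folded_lead // mulVg.
(* An inner automorphism makes the element at [ord0] trivial and preserves every [c_ij]; each [g2 i]
   then has trivial leading letter as well. *)
pose h := undec S (g1 ord0); have dh : dec S h = g1 ord0 by apply: undecK.
pose g2 i := g1 i / g1 ord0.
have {}m : marking (psi * inner h^-1) g2 phi1.
  by move=> i x; rewrite (marking_inner h^-1 m) gmulfV dh.
have g2P i j : i != j -> lead i (g2 i / g2 j) = 1.
  by move=> ij; rewrite /g2 mulgKA g1P.
have g20 i : lead i (g2 i) = 1.
  have [->|i0] := eqVneq i ord0; first by rewrite /g2 mulgV lead1.
  by rewrite g1P.
have /(marking_trivial m) e := tight_trivial nontrivial m g20 g2P.
exists phi1, h; rewrite -e -mulgA -gmulfM mulVg.
by rewrite gmulf1 mulg1.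
Qed.

Lemma pure_symmetric_ind (P : aut G -> Prop) :
    (forall (phi : Phi S) h, P (factor_aut phi * inner h)) ->
    (forall i j (ij : i != j) (a : subgrp (S i)) psi,
       P (pconj ij a * psi) -> P psi) ->
  forall psi, pure_symmetric S psi -> P psi.
Proof.
move=> P0 P1 psi /marking_ex[g [phi m]].
have [n] := ubnP (spread g); elim: n psi g m => // n IHn psi g m; rewrite ltnS => gn.
have [fg|] := boolP [forall i, folded g i].
  by have [|chi [h ->]] := folded_factor m; [apply/forallP|apply: P0].
rewrite negb_forall => /existsP[i /spread_twist[j [b [ij lt]]]].
(* Composing with [pconj ij a] twists by [phi i a], hence the preimage of [b]. *)
apply: (P1 _ _ ij (aut_inv (phi i) b)).
apply: (IHn _ (twist j b g)); last by apply: leq_trans lt gn.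
by rewrite -[b in X in marking _ X](autVK (phi i)); apply: marking_pconj.
Qed.

Fixpoint word_aut (w : seq (syllable K)) : aut G :=
  if w is existT i x :: w' then pconj (nxt_neq i) x * word_aut w' else 1.

(** The factor of the first letter can be read off [g]: each letter added in front unfolds its own
    index, and at most one index is unfolded. *)
Lemma word_aut_marking w (phi : Phi S) : reduced w ->
  exists2 g, marking (word_aut w * factor_aut phi) g phi
           & forall i, folded g i = ~~ starts i w.
Proof.
elim: w => [_|[i x] w IHw].
  exists (fun=> 1); first by rewrite mul1g; apply: marking_factor.
  by move=> i; rewrite /folded eqxx.
rewrite reduced_cons => /and3P[x1 xw /IHw[g m gP]].
exists (twist (nxt i) (phi i x) g).
  by rewrite /= -mulgA; apply: marking_pconj.
have u : ~~ folded (twist (nxt i) (phi i x) g) i.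
  by apply: twist_unfold; rewrite ?nxt_neq ?aut_neq1 ?gP.
by move=> j /=; have [<-|ij] := eqVneq i j; [apply/negbTE|apply: unfolded_uniq u ij].
Qed.

(** Here [c_ij] is [z i / z j], whose leading letter in [G_i] is [z i] whatever [j] is. *)
Lemma inner_folded h g (phi : Phi S) : marking (inner h) g phi -> forall i, folded g i.
Proof.
move=> /(marking_of_inner nontrivial)[z gE] i; rewrite /folded.
by rewrite !gE !mulgKA -!gmulfV !leadMr ?eqxx // eq_sym ?nxt_neq ?nxt2_neq.
Qed.

Lemma inner_factor (phi : Phi S) h : factor_aut phi = inner h -> phi = 1.
Proof.
move=> e; have := marking_factor phi; rewrite e => /(marking_of_inner nontrivial)[z zE].
have hz i : dec S h = fpin (z i)^-1.
  by rewrite gmulfV -(mulKg (fpin (z i)) (dec S h)) -zE mulg1.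
(* [dec h] lies in two distinct factors, which meet trivially. *)
have h1 : dec S h = 1.
  rewrite (hz ord0) -[RHS](@gmulf1 _ _ (fpin (K := K) (i := ord0))); congr fpin.
  by rewrite -[LHS](@lead_fpin _ K) -hz (hz (nxt ord0)) lead_fpin_neq // eq_sym nxt_neq.
have {}h1 : h = 1 by apply: (can_inj (@decK _ _ S)); rewrite h1 gmulf1.
apply: functional_extensionality_dep => i; apply: aut_ext => x.
apply/val_inj; rewrite -[LHS]/(sgval (phi i x)) -factor_autE e h1.
by rewrite gmulf1.
Qed.

Lemma word_aut_inj w (phi : Phi S) h : reduced w ->
  word_aut w * factor_aut phi = inner h -> w = [::] /\ phi = 1.
Proof.
move=> rw e; have [g] := word_aut_marking phi rw.
rewrite e => /inner_folded fg gP.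
have w0 : w = [::].
  by case: w {rw e} gP => // -[i x] w /(_ i); rewrite fg /= eqxx.
by split=> //; move: e; rewrite w0 mul1g; apply: inner_factor.
Qed.

End Generation.

(** * The presented group *)

Section QuotientLift.
Local Open Scope group_scope.
Variable G : groupType.

Lemma cls_eq1 (N : normal_subgroup G) x : cls N x = 1 <-> x \in N.
Proof.
have -> : (cls N x = 1) = (cls N x = cls N 1) by rewrite gmulf1.
split=> [/eqP|xN]; last apply/eqP; rewrite eqmodE /= /coset_rel mulg1 gpredV //.
Qed.

Variables (L : groupType) (f : {hom G -> L}).

Definition ker : {pred G} := [pred x | f x == 1].

Fact ker_mul : mulg_closed ker.
Proof. by move=> x y /eqP fx /eqP fy; rewrite inE gmulfM fx fy mulg1. Qed.
Fact ker_one : 1 \in ker.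
Proof. by rewrite inE gmulf1. Qed.
Fact ker_inv : invg_closed ker.
Proof. by move=> x /eqP fx; rewrite inE gmulfV fx invg1. Qed.
HB.instance Definition _ := isMulClosed.Build G ker ker_mul.
HB.instance Definition _ := isMul1Closed.Build G ker ker_one.
HB.instance Definition _ := isInvClosed.Build G ker ker_inv.

Fact ker_normal x g : x \in ker -> x ^ g \in ker.
Proof. by rewrite !inE gmulfJ conjg_eq1. Qed.
Definition nker : normal_subgroup G := NormalSubgroup ker_normal.

Lemma quotient_lift (R : set G) : (forall r, R r -> f r = 1) ->
  exists theta : {hom quotg (nclosure R) -> L}, forall x, theta (cls _ x) = f x.
Proof.
move=> fR; pose t (q : quotg (nclosure R)) := f (repr q).
have tE x : t (cls _ x) = f x.
  have /set_mem kerR := repr_piE (nclosure R) x.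
  have : x^-1 * repr (\pi_(quotg (nclosure R)) x)%qT \in nker.
    by apply: kerR => r /fR fr; rewrite inE fr.
  by rewrite inE gmulfM gmulfV => /eqP/mulg1_eq; rewrite invgK.
have tM : {morph t : x y / x * y}.
  elim/quotg_elim=> x; elim/quotg_elim=> y.
  by rewrite -!/(cls _ _) -gmulfM !tE gmulfM.
pose tH := isUMagmaMorphism.Build _ _ t (group_hom tM).
pose theta : {hom quotg (nclosure R) -> L} := HB.pack t tH.
by exists theta.
Qed.

End QuotientLift.

(** * Verification of the relations, and normal forms in the presented group *)

Section Presentation.
Local Open Scope group_scope.
Variables (G : groupType) (S : free_splitting 'I_3 G).
Local Notation K := (fun i => subgrp (S i)).
Local Notation F := (freeprod K).

Lemma oclsM : {morph @ocls G : f g / f * g}.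
Proof. exact: gmulfM. Qed.

Lemma ocls_eqP (f g : aut G) : ocls f = ocls g <-> exists h, f = g * inner h.
Proof.
split=> [e|[h ->]].
  have : (ocls g)^-1 * ocls f = 1 by rewrite e mulVg.
  rewrite -gmulfV -gmulfM => /cls_eq1/set_mem[h _ hE].
  by exists h; rewrite hE mulVKg.
have h1 : ocls (inner h) = 1 by apply/cls_eq1/mem_set; exists h.
by rewrite gmulfM /= h1 mulg1.
Qed.

Lemma aut_ext_factor (f g : aut G) :
  (forall i (x : subgrp (S i)), f (sgval x) = g (sgval x)) -> f = g.
Proof.
by move=> e; apply/aut_ext/(@slift_ext _ _ S _ (f : {hom _ -> _}) (g : {hom _ -> _})).
Qed.

Lemma aut_mulE (f g : aut G) x : (f * g) x = g (f x).
Proof. by []. Qed.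

Lemma autV (f : aut G) x : f x^-1 = (f x)^-1.
Proof. exact: gmulfV. Qed.

Lemma pconj_comm i j k (ij : i != j) (ik : i != k) (jk : j != k)
    (g h : subgrp (S i)) :
  pconj ij g * pconj ik h = pconj ik h * pconj ij g.
Proof.
apply: aut_ext_factor => l x; rewrite !aut_mulE !pconjE.
have [lj|lj] := eqVneq l j.
  subst l; rewrite (negbTE jk) !autM !autV !pconjE ?eqxx.
  by rewrite (negbTE ik) (negbTE jk).
have [lk|lk] := eqVneq l k.
  subst l; rewrite !autM !autV !pconjE ?eqxx.
  by rewrite (negbTE ij) (negbTE lj).
by rewrite !pconjE (negbTE lj) (negbTE lk).
Qed.

(** The first two maps conjugate both other factors by [g]; the inner automorphism undoes this and
    conjugates [G_i] instead. *)
Lemma pconj_Ad i j k (ij : i != j) (ik : i != k) (jk : j != k) (g : subgrp (S i)) :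
  pconj ij g * pconj ik g * inner (sgval g) = factor_aut (Ad g).
Proof.
apply: aut_ext_factor => l x; rewrite !aut_mulE factor_autE /Ad.
have conjK (y : G) : inner (sgval g) (sgval g * y * (sgval g)^-1) = y.
  by rewrite /= conjgE !mulgA mulVg mul1g mulgVK.
rewrite pconjE; have [lj|lj] := eqVneq l j.
  subst l; rewrite [pconj ik g _]autM [pconj ik g _]autM autV !pconjE.
  by rewrite (negbTE ik) (negbTE jk) conjK dfwith_out.
rewrite pconjE; have [lk|lk] := eqVneq l k.
  by subst l; rewrite conjK dfwith_out.
have li : l = i.
  apply/eqP; move: ij ik jk lj lk; rewrite -!val_eqE /=.
  by move: (ltn_ord i) (ltn_ord j) (ltn_ord k) (ltn_ord l); lia.
by subst l; rewrite dfwith_in.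
Qed.

Lemma pconj_factor i j (ij : i != j) (g : subgrp (S i)) (phi : Phi S) :
  pconj ij g * factor_aut phi = factor_aut phi * pconj ij (phi i g).
Proof.
apply: aut_ext_factor => l x; rewrite !aut_mulE factor_autE !pconjE.
by case: eqP => _; rewrite ?autM ?autV !factor_autE.
Qed.

Definition gen_eval : {hom gen_free S -> Out_pure S} := fplift (gen_hom S).

Lemma gen_eval_f i j (ij : i != j) (g : subgrp (S i)) :
  gen_eval (gen_f ij g) = fcls ij g.
Proof. exact: fplift_in. Qed.

Lemma gen_eval_Phi phi : gen_eval (gen_Phi phi) = Phi_out phi.
Proof. exact: fplift_in. Qed.

(** Relations 1 and 3 hold between automorphisms, relation 2 modulo an inner one. *)
Lemma gen_eval_relator r : @relator G S r -> gen_eval r = 1.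
Proof.
have sI : injective (@sgval _ (pure_out S)) by apply: val_inj.
case=> {r} [i j k ij ik jk g h|i j k ij ik jk g|i j ij g phi].
- apply/eqP; rewrite gmulfR !gen_eval_f; apply/commgP/sI.
  rewrite -[LHS]/(ocls (pconj ij g) * ocls (pconj ik h)).
  by rewrite -oclsM pconj_comm // oclsM.
- rewrite !gmulfM gmulfV !gen_eval_f !gen_eval_Phi.
  apply: (canLR (mulgK _)); rewrite mul1g; apply: sI.
  rewrite -[LHS]/(ocls (pconj ij g) * ocls (pconj ik g)) -oclsM.
  by apply/esym/ocls_eqP; exists (sgval g); rewrite pconj_Ad.
- rewrite !gmulfM !gmulfV !gen_eval_f !gen_eval_Phi.
  apply: (canLR (mulgK _)); rewrite mul1g.
  apply: (mulgI (Phi_out phi)); rewrite -mulgA mulVKg; apply: sI.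
  rewrite -[LHS]/(ocls (pconj ij g) * ocls (factor_aut phi)).
  by rewrite -[RHS]/(ocls (factor_aut phi) * ocls _) -!oclsM pconj_factor.
Qed.

Local Notation Q := (quotg (nclosure (@relator G S))).

Definition pf i j (ij : i != j) (g : subgrp (S i)) : Q := cls _ (gen_f ij g).
Definition pPhi (phi : Phi S) : Q := cls _ (gen_Phi phi).

Lemma pfM i j (ij : i != j) : {morph @pf i j ij : g h / g * h}.
Proof.
move=> g h; rewrite /pf /gen_f -!gmulfM; congr (cls _ (fpin _)).
by apply/val_inj; rewrite /= fclsM.
Qed.
HB.instance Definition _ i j (ij : i != j) :=
  isUMagmaMorphism.Build (subgrp (S i)) Q (pf ij) (group_hom (pfM ij)).

Lemma pPhiM : {morph pPhi : phi chi / phi * chi}.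
Proof. by move=> phi chi; rewrite /pPhi /gen_Phi -!gmulfM. Qed.
HB.instance Definition _ :=
  isUMagmaMorphism.Build (Phi S) Q pPhi (group_hom pPhiM).

Lemma relator1 r : @relator G S r -> cls (nclosure (@relator G S)) r = 1.
Proof. by move=> Rr; apply/cls_eq1/mem_set => N; apply. Qed.

Lemma pf_Ad i j k (ij : i != j) (ik : i != k) (jk : j != k) (g : subgrp (S i)) :
  pf ik g = (pf ij g)^-1 * pPhi (Ad g).
Proof.
have /divg1_eq <- : pf ij g * pf ik g / pPhi (Ad g) = 1.
  by rewrite -(relator1 (rel_Ad ij ik jk g)) !gmulfM gmulfV.
by rewrite mulKg.
Qed.

Lemma pPhi_pf i j (ij : i != j) (g : subgrp (S i)) phi :
  pf ij g * pPhi phi = pPhi phi * pf ij (phi i g).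
Proof.
have /divg1_eq <- : (pPhi phi)^-1 * pf ij g * pPhi phi / pf ij (phi i g) = 1.
  by rewrite -(relator1 (rel_conj ij g phi)) !gmulfM !gmulfV.
by rewrite -mulgA mulVKg.
Qed.

Fixpoint pword (w : seq (syllable K)) : Q :=
  if w is existT i x :: w' then pf (nxt_neq i) x * pword w' else 1.

Lemma pword_Phi w phi : exists w', pPhi phi * pword w = pword w' * pPhi phi.
Proof.
elim: w => [|[i x] w [w' IHw]]; first by exists [::]; rewrite mulg1 mul1g.
exists (syl (aut_inv (phi i) x) :: w') => /=.
by rewrite -mulgA -IHw !mulgA pPhi_pf autVK.
Qed.

Lemma pword_eqv u v : fp_eqv u v -> pword u = pword v.
Proof.
elim=> {u v} //=.
- by move=> v u w _ -> _ ->.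
- have cat u v : pword (u ++ v) = pword u * pword v.
    by elim: u => [|[i x] u IHu] /=; rewrite ?mul1g // IHu mulgA.
  by move=> u u' v v' _ e1 _ e2; rewrite !cat e1 e2.
- by move=> i x y; rewrite !mulg1 -gmulfM.
- by move=> i; rewrite gmulf1 mulg1.
Qed.

(** The products [pword w * pPhi phi] are stable under left multiplication by each generator. *)
Lemma pword_normal (q : Q) : exists w phi, reduced w /\ q = pword w * pPhi phi.
Proof.
suff [w [phi ->]] : exists w phi, q = pword w * pPhi phi.
  exists (nf (\pi_F w)%qT), phi; split; first exact: nf_reduced.
  by congr (_ * _); apply/pword_eqv/fp_piP; rewrite nfK.
suff H (u : seq (syllable (@gen_grp _ _ S))) :
    exists w phi, cls _ (\pi_(gen_free S) u)%qT = pword w * pPhi phi :> Q.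
  by elim/quotg_elim: q; elim/fp_elim=> u; apply: H.
elim: u => [|[a x] u [w [phi e]]].
  by exists [::], 1; rewrite -[(\pi _)%qT]/(1 : gen_free S) !gmulf1 mul1g.
rewrite -[existT _ a x]/(syl x) pi_cons.
have -> : cls _ (fpin x * (\pi_(gen_free S) u)%qT) =
    cls _ (fpin x) * (pword w * pPhi phi).
  by rewrite -e; apply: clsM.
clear e.
case: a x => [[[i j] /= ij]|] x; last first.
  have [w' e] := pword_Phi w x; exists w', ((x : Phi S) * phi).
  by rewrite gmulfM mulgA -[cls _ _]/(pPhi x) e mulgA.
have [g ->] : exists g, x = to_img (fcls ij) g.
  by case: x => x xP; have /set_mem[g _ e] := xP; exists g; apply/val_inj.
rewrite -[cls _ (fpin _)]/(pf ij g).
have [jE|jE] := nxtP ij.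
  subst j; exists (syl g :: w), phi; rewrite /= mulgA; congr (pf _ _ * _ * _).
  exact: bool_irrelevance.
(* The generator [f_{i_{i+2}}(g)] is rewritten by relation 2, and the resulting [Ad g] is moved to
   the right past the word. *)
subst j; have [w' e] := pword_Phi w (Ad g).
exists (syl g^-1 :: w'), (Ad g * phi).
rewrite (pf_Ad (nxt_neq i) ij (nxt_neq _)).
by rewrite /= gmulfV -!mulgA; congr (_ * _); rewrite !mulgA e gmulfM !mulgA.
Qed.

End Presentation.

Theorem theorem4p3p1 (G : groupType) (S : free_splitting 'I_3 G)
  (nontrivial : forall i : 'I_3, exists2 x : G, x \in S i & x != 1%g) :
  presented_by (gen_hom S) (@relator G S).
Proof.
have [theta thetaE] := quotient_lift (@gen_eval_relator G S).
exists theta; split; first by move=> i x; rewrite thetaE [LHS]fplift_in.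
have thw (w : seq (syllable (fun i => subgrp (S i)))) (phi : Phi S) :
    sgval (theta (pword w * pPhi phi))%g = ocls (word_aut w * factor_aut phi)%g.
  rewrite !gmulfM; congr (_ * _)%g; last by rewrite thetaE gen_eval_Phi.
  elim: w => [|[i x] w IHw] /=; first by rewrite !gmulf1.
  by rewrite !gmulfM IHw thetaE gen_eval_f.
have inj : injective theta.
  (* A normal form in the kernel yields an inner automorphism, which forces an empty word and a
     trivial [phi]. *)
  apply: gmulf_inj => q; have [w [phi [rw ->]]] := pword_normal q.
  move/(congr1 (@sgval _ _)); rewrite thw gmulf1 -[RHS]/(ocls (1%g : aut G)).
  case/ocls_eqP => h; rewrite mul1g => /(word_aut_inj nontrivial rw)[-> ->].
  by rewrite gmulf1 mulg1.
have surj y : exists q, theta q = y.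
  case: y => y yP; have /set_mem[psi + e] := yP.
  suff H : pure_symmetric S psi -> exists q, sgval (theta q) = ocls psi.
    by move=> /H[q eq]; exists q; apply/val_inj/(etrans eq).
  move: psi {e}; apply: (pure_symmetric_ind nontrivial
    (P := fun psi => exists q, sgval (theta q) = ocls psi)) => [phi h|i j ij a psi].
    exists (pPhi phi); rewrite thetaE gen_eval_Phi.
    by apply/esym/ocls_eqP; exists h.
  (* As [q] maps to the class of [pconj ij a * psi], dividing by [pf ij a] on the left reaches
     [psi]. *)
  case=> q e; exists ((pf ij a)^-1 * q)%g.
  have -> : sgval (theta ((pf ij a)^-1 * q))%g =
      ((sgval (theta (pf ij a)))^-1 * sgval (theta q))%g.
    by rewrite !gmulfM !gmulfV.
  by rewrite e thetaE gen_eval_f oclsM mulKg.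
have /choice[inv invK] := surj.
by exists inv => // q; apply: inj; rewrite invK.
Qed.
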